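(* Let $m\ge 1$ and $\mathbf{A}\in\mathbb{H}^{m\times m}$, and let $\mathbf{I}$ be the $m\times m$ identity matrix. A quaternion $\lambda\in\mathbb{H}$ is a left eigenvalue of $\mathbf{A}$ if and only if $\det\mathcal{P}_1(\mathbf{A}-\lambda\mathbf{I})=0$.
   Context: $\mathbb{H}$ denotes the quaternions; $q\in\mathbb{H}$ is written $q=[q]_0+[q]_1\hbar+[q]_2\jmath+[q]_3\kappa$ with real coefficients and $\hbar^2=\jmath^2=\kappa^2=\hbar\jmath\kappa=-1$. A quaternion $\lambda$ is a left eigenvalue of $\mathbf{A}\in\mathbb{H}^{m\times m}$ if $\mathbf{A}\mathbf{x}=\lambda\mathbf{x}$ for some nonzero $\mathbf{x}\in\mathbb{H}^{m\times 1}$. Let $\mathbf{E}$ be the $4\times4$ identity matrix and $$\mathbf{H}_1=\begin{pmatrix}0&-1&0&0\\1&0&0&0\\0&0&0&-1\\0&0&1&0\end{pmatrix},\quad \mathbf{J}_1=\begin{pmatrix}0&0&-1&0\\0&0&0&1\\1&0&0&0\\0&-1&0&0\end{pmatrix},\quad \mathbf{K}_1=\begin{pmatrix}0&0&0&-1\\0&0&-1&0\\0&1&0&0\\1&0&0&0\end{pmatrix}.$$ Define $\mathcal{Q}_1(q)=[q]_0\mathbf{E}+[q]_1\mathbf{H}_1+[q]_2\mathbf{J}_1+[q]_3\mathbf{K}_1\in\mathbb{R}^{4\times4}$, and for $\mathbf{A}=(a_{ij})\in\mathbb{H}^{m\times n}$ let $\mathcal{P}_1(\mathbf{A})=(\mathcal{Q}_1(a_{ij}))\in\mathbb{R}^{4m\times4n}$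 be the block matrix with blocks $\mathcal{Q}_1(a_{ij})$. The function $\lambda\mapsto\det\mathcal{P}_1(\mathbf{A}-\lambda\mathbf{I})$ is called the generalized characteristic polynomial of $\mathbf{A}$. *)

(* Defs.v *)
From HB Require Import structures.
From mathcomp Require Import all_boot all_order all_algebra.
From mathcomp Require Import reals.
From mathcomp Require Import ring.

Set Implicit Arguments.
Unset Strict Implicit.
Unset Printing Implicit Defensive.

Import Order.TTheory GRing.Theory Num.Theory.
Local Open Scope ring_scope.

(* [Quat a b c d] stands for a + b i + c j + d k. *)
Record quat (R : Type) := Quat { qt0 : R; qt1 : R; qt2 : R; qt3 : R }.

Definition tuple_of_quat (R : Type) (q : quat R) : R * R * R * R :=
  (qt0 q, qt1 q, qt2 q, qt3 q).
Definition quat_of_tuple (R : Type) (t : R * R * R * R) : quat R :=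
  Quat t.1.1.1 t.1.1.2 t.1.2 t.2.
Lemma tuple_of_quatK (R : Type) :
  cancel (@tuple_of_quat R) (@quat_of_tuple R).
Proof. by case. Qed.

HB.instance Definition _ (R : choiceType) :=
  Choice.copy (quat R) (can_type (@tuple_of_quatK R)).

Section QuatRing.
Variable R : realType.
Implicit Types p q r : quat R.

Definition quat_add p q : quat R :=
  Quat (qt0 p + qt0 q) (qt1 p + qt1 q) (qt2 p + qt2 q) (qt3 p + qt3 q).
Definition quat_opp p : quat R := Quat (- qt0 p) (- qt1 p) (- qt2 p) (- qt3 p).
Definition quat_zero : quat R := Quat 0 0 0 0.
Definition quat_one : quat R := Quat 1 0 0 0.

(* Bilinear extension of i^2 = j^2 = k^2 = ijk = -1; see [quat_units]. *)
Definition quat_mul p q : quat R :=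
  let: Quat a0 a1 a2 a3 := p in
  let: Quat b0 b1 b2 b3 := q in
  Quat (a0 * b0 - a1 * b1 - a2 * b2 - a3 * b3)
       (a0 * b1 + a1 * b0 + a2 * b3 - a3 * b2)
       (a0 * b2 - a1 * b3 + a2 * b0 + a3 * b1)
       (a0 * b3 + a1 * b2 - a2 * b1 + a3 * b0).

Lemma quat_addA : associative quat_add.
Proof. by move=> [????] [????] [????]; congr Quat; apply: addrA. Qed.
Lemma quat_addC : commutative quat_add.
Proof. by move=> [????] [????]; congr Quat; apply: addrC. Qed.
Lemma quat_add0 : left_id quat_zero quat_add.
Proof. by move=> [????]; congr Quat; apply: add0r. Qed.
Lemma quat_addN : left_inverse quat_zero quat_opp quat_add.
Proof. by move=> [????]; congr Quat; apply: addNr. Qed.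

HB.instance Definition _ :=
  GRing.isZmodule.Build (quat R) quat_addA quat_addC quat_add0 quat_addN.

Lemma quat_mulA : associative quat_mul.
Proof. by move=> [????] [????] [????]; congr Quat; ring. Qed.
Lemma quat_mul1l : left_id quat_one quat_mul.
Proof. by move=> [????]; congr Quat; ring. Qed.
Lemma quat_mul1r : right_id quat_one quat_mul.
Proof. by move=> [????]; congr Quat; ring. Qed.
Lemma quat_mulDl : left_distributive quat_mul quat_add.
Proof. by move=> [????] [????] [????]; congr Quat => /=; ring. Qed.
Lemma quat_mulDr : right_distributive quat_mul quat_add.
Proof. by move=> [????] [????] [????]; congr Quat => /=; ring. Qed.
Lemma quat_one_neq0 : quat_one != quat_zero.
Proof. by apply/eqP => -[] /eqP; rewrite oner_eq0. Qed.

HB.instance Definition _ :=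
  GRing.Zmodule_isNzRing.Build (quat R)
    quat_mulA quat_mul1l quat_mul1r quat_mulDl quat_mulDr quat_one_neq0.

Definition hbar : quat R := Quat 0 1 0 0.
Definition jmath : quat R := Quat 0 0 1 0.
Definition kappa : quat R := Quat 0 0 0 1.

Lemma quat_units :
  [/\ hbar * hbar = -1, jmath * jmath = -1, kappa * kappa = -1
    & hbar * jmath * kappa = -1].
Proof. by split; congr Quat => /=; ring. Qed.

End QuatRing.

Definition mx4 (R : realType) (rows : seq (seq R)) : 'M[R]_4 :=
  \matrix_(i < 4, j < 4) nth 0 (nth [::] rows i) j.

Definition H1 (R : realType) : 'M[R]_4 :=
  mx4 [:: [:: 0; -1; 0;  0];
          [:: 1;  0; 0;  0];
          [:: 0;  0; 0; -1];
          [:: 0;  0; 1;  0]].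

Definition J1 (R : realType) : 'M[R]_4 :=
  mx4 [:: [:: 0;  0; -1; 0];
          [:: 0;  0;  0; 1];
          [:: 1;  0;  0; 0];
          [:: 0; -1;  0; 0]].

Definition K1 (R : realType) : 'M[R]_4 :=
  mx4 [:: [:: 0; 0;  0; -1];
          [:: 0; 0; -1;  0];
          [:: 0; 1;  0;  0];
          [:: 1; 0;  0;  0]].

Definition Q1 (R : realType) (q : quat R) : 'M[R]_4 :=
  qt0 q *: 1%:M + qt1 q *: H1 R + qt2 q *: J1 R + qt3 q *: K1 R.

(* The dimensions [\sum_(i < m) 4] and [\sum_(j < n) 4] are 4m and 4n, in the
   form in which [\mxblock] presents them. *)
Definition P1 (R : realType) (m n : nat) (A : 'M[quat R]_(m, n)) :
    'M[R]_(\sum_(i < m) 4, \sum_(j < n) 4) :=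
  \mxblock_(i < m, j < n) Q1 (A i j).

(* Scalars act on matrices over a noncommutative ring by left multiplication:
   [(lambda *: x) i j = lambda * x i j]. *)
Definition left_eigenvalue (R : realType) (m : nat) (A : 'M[quat R]_m)
    (lambda : quat R) : Prop :=
  exists2 x : 'cV[quat R]_m, x != 0 & A *m x = lambda *: x.

(* Main.v *)
Require Import Defs.
From HB Require Import structures.
From mathcomp Require Import all_boot all_order all_algebra.
From mathcomp Require Import reals.
From mathcomp Require Import ring.

Set Implicit Arguments.
Unset Strict Implicit.
Unset Printing Implicit Defensive.

Import Order.TTheory GRing.Theory Num.Theory.
Local Open Scope ring_scope.

(** [Q1 q] is the matrix of the left multiplication by [q] on the real vector
    space of quaternions with basis 1, i, j, k. So, after splitting every
    coordinate into its four real components, [P1 B] is the matrix of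
    [x |-> B x], and its determinant vanishes exactly when [B x = 0] has a
    nonzero solution. *)

Definition quat_col (R : realType) (q : quat R) : 'cV[R]_4 :=
  \col_(i < 4) nth 0 [:: qt0 q; qt1 q; qt2 q; qt3 q] i.

Definition col_quat (R : realType) (v : 'cV[R]_4) : quat R :=
  Quat (v 0 0) (v 1 0) (v 2%:R 0) (v 3%:R 0).

Lemma quat_colK (R : realType) : cancel (@quat_col R) (@col_quat R).
Proof. by case=> a b c d; rewrite /col_quat !mxE. Qed.

Lemma col_quatK (R : realType) : cancel (@col_quat R) (@quat_col R).
Proof.
move=> v; apply/matrixP=> i j; rewrite (ord1 j) mxE.
by case: i => [[|[|[|[|//]]]] lti] /=; congr (v _ _); apply: val_inj.
Qed.

Lemma quat_colB (R : realType) : {morph @quat_col R : p q / p - q}.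
Proof.
move=> [a b c d] [a' b' c' d']; apply/matrixP=> i j; rewrite !mxE.
by case: i => [[|[|[|[|//]]]] lti].
Qed.

(** Additivity lets [raddf0] and [raddf_sum] move [quat_col] through zero and through the sums in a
    matrix product. *)
HB.instance Definition _ (R : realType) :=
  GRing.isZmodMorphism.Build (quat R) 'cV[R]_4 (@quat_col R) (@quat_colB R).

(** The columns of [Q1 p] hold the coordinates of [p], [p * hbar], [p * jmath] and [p * kappa]. *)
Lemma Q1_mul_quat_col (R : realType) (p q : quat R) :
  Q1 p *m quat_col q = quat_col (p * q).
Proof.
case: p q => [a b c d] [a' b' c' d']; apply/matrixP=> i j.
rewrite mxE !big_ord_recl big_ord0 !mxE /=.
by case: i => [[|[|[|[|//]]]] lti]; rewrite /=; ring.
Qed.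

Section RealCoordinates.
Variables (R : realType) (m : nat).
Implicit Types (B : 'M[quat R]_m) (x : 'cV[quat R]_m).

Definition real_coords x : 'cV[R]_(\sum_(i < m) 4) :=
  \mxcol_(i < m) quat_col (x i 0).

Definition of_real_coords (v : 'cV[R]_(\sum_(i < m) 4)) : 'cV[quat R]_m :=
  \col_(i < m) col_quat (submxcol v i).

Lemma real_coordsK : cancel real_coords of_real_coords.
Proof. by move=> x; apply/colP=> i; rewrite mxE mxcolK quat_colK. Qed.

(** Surjectivity of [real_coords]: every real kernel vector of [P1 B] comes from a quaternion
    vector. *)
Lemma of_real_coordsK : cancel of_real_coords real_coords.
Proof. by move=> v; apply/mxcolP=> i; rewrite mxcolK mxE col_quatK. Qed.

Lemma real_coords0 : real_coords 0 = 0.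
Proof. by apply/mxcolP=> i; rewrite mxcolK submxcol0 mxE raddf0. Qed.

Lemma real_coords_eq0 x : (real_coords x == 0) = (x == 0).
Proof. by rewrite -[in LHS]real_coords0 (can_eq real_coordsK). Qed.

Lemma P1_mul_real_coords B x : P1 B *m real_coords x = real_coords (B *m x).
Proof.
rewrite /P1 mul_mxblock_mxrow; apply: eq_mxcol => i; rewrite mxE raddf_sum.
by apply: eq_bigr => j _; rewrite Q1_mul_quat_col.
Qed.

Lemma det_P1_eq0 B :
  \det (P1 B) = 0 <-> exists2 x : 'cV[quat R]_m, x != 0 & B *m x = 0.
Proof.
(* [det0P] speaks of row vectors killed by right multiplication with the matrix. Applied to the
   transpose of [P1 B], it gives the column kernel of [P1 B]. *)
rewrite -det_tr; split=> [/eqP/det0P[v v_neq0 vP0] | [x x_neq0 Bx0]].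
  exists (of_real_coords v^T).
    by rewrite -real_coords_eq0 of_real_coordsK trmx_eq0.
  apply/eqP; rewrite -real_coords_eq0 -P1_mul_real_coords of_real_coordsK.
  by rewrite -trmx_eq0 trmx_mul trmxK vP0.
apply/eqP/det0P; exists (real_coords x)^T.
  by rewrite trmx_eq0 real_coords_eq0.
by rewrite -trmx_mul P1_mul_real_coords Bx0 real_coords0 trmx0.
Qed.

End RealCoordinates.

Theorem mainTheorem1 (R : realType) (m : nat) (hm : (1 <= m)%N)
    (A : 'M[quat R]_m) (lambda : quat R) :
  left_eigenvalue A lambda <-> \det (P1 (A - lambda%:M)) = 0.
Proof.
(* [lambda%:M] multiplies the entries of [x] by [lambda] on the left, so eigenvectors for [lambda]
   are exactly the nonzero kernel vectors of [A - lambda%:M]. *)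
rewrite det_P1_eq0; split=> -[x x_neq0 Ax]; exists x => //.
  by rewrite mulmxBl mul_scalar_mx Ax subrr.
by apply/eqP; rewrite -subr_eq0 -mul_scalar_mx -mulmxBl Ax.
Qed.
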